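(* Let $A$ be a consequence-based algorithm that is correct for a c-property $\mathcal{P}$. Let $\mathcal{O}$ be an ontology in normal form and $\alpha$ an axiom with $(\mathcal{O},\alpha)\in\mathcal{P}$. Suppose $\mathcal{O}^{pin}\rightharpoonup^*\mathcal{A}^{pin}$, $\alpha:\varphi_\alpha\in\mathcal{A}^{pin}$, and $\mathcal{A}^{pin}$ is pinpointing saturated. Then $\varphi_\alpha$ is a pinpointing formula for $\alpha$ w.r.t. $\mathcal{O}$ and $\mathcal{P}$: for every valuation $\mathcal{V}\subseteq\mathrm{lab}(\mathcal{O})$, $(\mathcal{O}_{\mathcal{V}},\alpha)\in\mathcal{P}$ iff $\mathcal{V}$ satisfies $\varphi_\alpha$.
   Context: Ontologies and c-properties. An ontology is a finite set of axioms from a fixed class of axioms. A c-property is a relation $\mathcal{P}$ between ontologies and axioms that is monotone: $\mathcal{O}\subseteq\mathcal{O}'$ and $(\mathcal{O},\alpha)\in\mathcal{P}$ imply $(\mathcal{O}',\alpha)\in\mathcal{P}$. Each axiom $\beta$ is labelled with a unique propositional variable $\mathrm{lab}(\beta)$, and $\mathrm{lab}(\mathcal{O})$ is the set of labels of axioms of $\mathcal{O}$. Valuations are identified with the set of variables they make true. For a valuation $\mathcal{V}$, $\mathcal{O}_{\mathcal{V}}:=\{\beta\in\mathcal{O}\mid\mathrm{lab}(\beta)\in\mathcal{V}\}$. Monotone Boolean formulae are built from variables and $\top,\bot$ using only $\wedge,\vee$. Consequence-based algorithms. The algorithm normalizes the input ontology and then works on states (finite sets of consequences), starting from the normalized ontology.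 Its rules are pairs $R=\mathcal{B}_0\to\mathcal{B}_1$ of finite sets of consequences. $R$ is applicable to a state $\mathcal{A}$ if $\mathcal{B}_0\subseteq\mathcal{A}$ and $\mathcal{B}_1\not\subseteq\mathcal{A}$, and its application yields $\mathcal{A}\cup\mathcal{B}_1$ (written $\to$; $\to^*$ is the reflexive-transitive closure). A state is saturated if no rule is applicable. For each ontology $\mathcal{O}$ there is a finite set $\delta(\mathcal{O})$ of derivable consequences. The algorithm is correct for $\mathcal{P}$ if, for every ontology $\mathcal{O}$: (i) a saturated state is reached after finitely many rule applications regardless of the application order; and (ii) if $\mathcal{O}\to^*\mathcal{A}$ with $\mathcal{A}$ saturated, then for every $\beta\in\delta(\mathcal{O})$, $(\mathcal{O},\beta)\in\mathcal{P}$ iff $\beta\in\mathcal{A}$. Pinpointing extension. A pinpointing state $\mathcal{A}^{pin}$ is a set of labelled consequences $\beta:\varphi_\beta$ ($\varphi_\beta$ a monotone Boolean formula, at most one label per consequence), with underlying consequence set $\mathcal{A}$. For a set $X$ of consequences, $\mathrm{fm}(X,\mathcal{A}^{pin}):=\bigwedge_{\beta\in X}\varphi_\beta$, with $\varphi_\beta:=\bot$ if $\beta\notin\mathcal{A}$. A rule $\mathcal{B}_0\to\mathcal{B}_1$ is pinpointing applicable if $\mathrm{fm}(\mathcal{B}_0,\mathcal{A}^{pin})\not\models\mathrm{fm}(\mathcal{B}_1,\mathcal{A}^{pin})$. Its pinpointing application ($\rightharpoonup$, with reflexive-transitive closure $\rightharpoonup^*$) replaces, for each $\beta\in\mathcal{B}_1$,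 the label $\varphi_\beta$ by $\varphi_\beta\vee\mathrm{fm}(\mathcal{B}_0,\mathcal{A}^{pin})$; absent consequences are added with label $\mathrm{fm}(\mathcal{B}_0,\mathcal{A}^{pin})$. A pinpointing state is pinpointing saturated if no rule is pinpointing applicable. For a normalized ontology $\mathcal{O}$, $\mathcal{O}^{pin}:=\{\beta:\mathrm{lab}(\beta)\mid\beta\in\mathcal{O}\}$.
   Formalization: Added assumption: for every O' ⊆ O, if (O',α) ∈ P or α is derived from O' by the rules, then α ∈ δ(O'). Without it the claim fails, since correctness says nothing about α outside δ. Normal form is read as a condition on single axioms, and normalization fixes ontologies in normal form. *)

(* Defs.v *)
(* MathComp world, with finite sets and finite maps from mathcomp-finmap. *)
From Stdlib Require Export Relations.
From mathcomp Require Export all_boot finmap.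
Set Implicit Arguments.
Unset Strict Implicit.
Unset Printing Implicit Defensive.

Local Open Scope fset_scope.
Local Open Scope fmap_scope.

(* [T] is the type of consequences and [L : {pred T}] the fixed class of those
   that are axioms; axioms occur in states, so both live in the same type. *)
Definition ontology (T : choiceType) (L : {pred T}) (O : {fset T}) : Prop :=
  {subset O <= L}.

Definition c_property (T : choiceType) (L : {pred T})
    (P : {fset T} -> T -> Prop) : Prop :=
  (forall O a, P O a -> ontology L O /\ a \in L) /\
  (forall O O' a, ontology L O' -> O `<=` O' -> P O a -> P O' a).

(* Being in normal form is a property of the individual axioms of an ontology;
   normalization does not change an ontology that is already in normal form.
   [rule B0 B1] means that B0 -> B1 is one of the (possibly infinitely many)
   rules. *)
Record cb_algorithm (T : choiceType) (L : {pred T}) := CBAlgorithm {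
  normal_axiom : {pred T};
  normalize : {fset T} -> {fset T};
  rule : {fset T} -> {fset T} -> Prop;
  delta : {fset T} -> {fset T};
  normalize_ontology : forall O, ontology L O -> ontology L (normalize O);
  normalize_normal :
    forall O, ontology L O -> {subset normalize O <= normal_axiom};
  normalize_id : forall O,
    ontology L O -> {subset O <= normal_axiom} -> normalize O = O;
  delta_axiom : forall O, ontology L O -> {subset delta O <= L}
}.

Section Saturation.
Variables (T : choiceType) (L : {pred T}) (alg : cb_algorithm L).

Definition normal_form (O : {fset T}) : Prop :=
  {subset O <= normal_axiom alg}.

Definition applicable (B0 B1 A : {fset T}) : Prop :=
  B0 `<=` A /\ ~ (B1 `<=` A).

Definition step (A A' : {fset T}) : Prop :=
  exists B0 B1, [/\ rule alg B0 B1, applicable B0 B1 A & A' = A `|` B1].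

Definition steps : {fset T} -> {fset T} -> Prop :=
  clos_refl_trans {fset T} step.

Definition saturated (A : {fset T}) : Prop :=
  forall B0 B1, rule alg B0 B1 -> ~ applicable B0 B1 A.

(* A state is saturated iff it has no [step]-successor, so termination under
   every order of rule application is the absence of infinite runs. *)
Definition terminating (O : {fset T}) : Prop :=
  ~ exists s : nat -> {fset T},
      s 0 = normalize alg O /\ forall n, step (s n) (s n.+1).

Definition correct (P : {fset T} -> T -> Prop) : Prop :=
  forall O, ontology L O ->
    terminating O /\
    forall A, steps (normalize alg O) A -> saturated A ->
      forall b, b \in delta alg O -> (P O b <-> b \in A).

Definition derived (O : {fset T}) (a : T) : Prop :=
  exists2 A, steps (normalize alg O) A & a \in A.

(* Correctness says nothing about axioms outside [delta]. This expresses that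
   [a] is one of the consequences that the algorithm is meant to decide for O
   and its subontologies. It does not ask for [a \in delta alg O'] outright:
   [delta alg O'] may be restricted to the signature of O', and may then omit
   [a] when it neither follows nor is derived from O'. *)
Definition in_scope (P : {fset T} -> T -> Prop) (O : {fset T}) (a : T) : Prop :=
  forall O', O' `<=` O -> P O' a \/ derived O' a -> a \in delta alg O'.

End Saturation.

Inductive mform (X : Type) : Type :=
| MVar of X
| MTop
| MBot
| MAnd of mform X & mform X
| MOr of mform X & mform X.

Arguments MTop {X}.
Arguments MBot {X}.

(* A valuation is the set, here a [{pred X}], of the variables it makes true. *)
Fixpoint sat (X : Type) (V : {pred X}) (f : mform X) : bool :=
  match f with
  | MVar x => x \in V
  | MTop => true
  | MBot => false
  | MAnd g h => sat V g && sat V h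
  | MOr g h => sat V g || sat V h
  end.

Definition entails (X : Type) (f g : mform X) : Prop :=
  forall V : {pred X}, sat V f -> sat V g.

Section Pinpointing.
Variables (T X : choiceType) (L : {pred T}) (lab : T -> X).

Definition restrict (O : {fset T}) (V : {pred X}) : {fset T} :=
  [fset b in O | lab b \in V].

Definition labels (O : {fset T}) : {fset X} := [fset lab b | b in O].

Definition pin_state := {fmap T -> mform X}.

Definition label (A : pin_state) (b : T) : mform X := odflt MBot A.[? b].

Definition fm (B : {fset T}) (A : pin_state) : mform X :=
  \big[@MAnd X/MTop]_(b <- B) label A b.

Definition pin_applicable (B0 B1 : {fset T}) (A : pin_state) : Prop :=
  ~ entails (fm B0 A) (fm B1 A).

Definition pin_apply (B0 B1 : {fset T}) (A : pin_state) : pin_state :=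
  [fmap x : domf A `|` B1 =>
     if val x \in B1 then
       if A.[? val x] is Some f then MOr f (fm B0 A) else fm B0 A
     else label A (val x)].

Definition pin_init (O : {fset T}) : pin_state :=
  [fmap x : O => MVar (lab (val x))].

Definition pin_step (alg : cb_algorithm L) (A A' : pin_state) : Prop :=
  exists B0 B1,
    [/\ rule alg B0 B1, pin_applicable B0 B1 A & A' = pin_apply B0 B1 A].

Definition pin_steps (alg : cb_algorithm L) : pin_state -> pin_state -> Prop :=
  clos_refl_trans pin_state (pin_step alg).

Definition pin_saturated (alg : cb_algorithm L) (A : pin_state) : Prop :=
  forall B0 B1, rule alg B0 B1 -> ~ pin_applicable B0 B1 A.

Definition pinpointing_formula (P : {fset T} -> T -> Prop) (O : {fset T})
    (a : T) (f : mform X) : Prop :=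
  forall V : {pred X}, {subset V <= labels O} ->
    (P (restrict O V) a <-> sat V f).

End Pinpointing.

(* Main.v *)
(* Fix a valuation V and send a pinpointing state to the set of consequences
   whose label V satisfies. This projection maps the initial pinpointing state of
   O to O_V, each pinpointing step to an ordinary step or to nothing, and
   pinpointing saturated states to saturated states. A pinpointing run from O
   therefore projects to a complete run from O_V, whose result contains a iff V
   satisfies the label of a. *)
Require Import Defs.
Set Implicit Arguments.
Unset Strict Implicit.
Unset Printing Implicit Defensive.
Local Open Scope fset_scope.
Local Open Scope fmap_scope.

Section Projection.
Variables (T X : choiceType) (L : {pred T}) (alg : cb_algorithm L).
Variables (lab : T -> X) (V : {pred X}).
Implicit Types (A : pin_state T X) (B O : {fset T}).

Definition proj A : {fset T} := [fset b in domf A | sat V (label A b)].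

(** The bound [domf A] only serves finiteness: a consequence outside it has label [MBot], which no
    valuation satisfies. *)
Lemma in_proj A b : (b \in proj A) = sat V (label A b).
Proof.
rewrite !inE /=; case: (boolP (b \in domf A)) => //= bNA.
by rewrite /label not_fnd.
Qed.

Lemma sat_fm B A : sat V (fm B A) = (B `<=` proj A).
Proof.
rewrite /fm (big_morph (sat V) (id1 := true) (op1 := andb)) // big_all.
apply/allP/fsubsetP => sB b bB; first by rewrite in_proj; apply: sB.
by rewrite -in_proj; apply: sB.
Qed.

Lemma sat_label_pin_apply B0 B1 A b :
  sat V (label (pin_apply B0 B1 A) b) =
  sat V (label A b) || (b \in B1) && (B0 `<=` proj A).
Proof.
rewrite -sat_fm /label; case: fndP => [bAB|].
  rewrite ffunE /=; case: ifP => _; last by rewrite orbF.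
  by case: (A.[? b]).
by rewrite inE negb_or => /andP[bNA /negPf ->]; rewrite not_fnd.
Qed.

Lemma proj_pin_apply B0 B1 A :
  proj (pin_apply B0 B1 A) =
  if B0 `<=` proj A then proj A `|` B1 else proj A.
Proof.
apply/fsetP => b; rewrite in_proj sat_label_pin_apply -in_proj.
by case: ifP => _; rewrite ?in_fsetU ?andbT ?andbF ?orbF.
Qed.

Lemma proj_pin_init O : proj (pin_init lab O) = restrict lab O V.
Proof.
apply/fsetP => b; rewrite in_proj /label !inE /=.
by case: fndP => [bO|/negPf bNO]; rewrite ?ffunE /= ?bO ?bNO.
Qed.

Lemma proj_pin_step A A' : pin_step alg A A' -> steps alg (proj A) (proj A').
Proof.
case=> B0 [B1 [r01 _ ->]]; rewrite proj_pin_apply.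
(* The valuation refuting the entailment need not be [V]: under [V], [B0] may fail or [B1] may hold
   already, and then the projection does not move. *)
case: ifP => [sB0|_]; last exact: rt_refl.
have [/fsetUidPl->|/negP nsB1] := boolP (B1 `<=` proj A); first exact: rt_refl.
by apply: rt_step; exists B0, B1.
Qed.

Lemma proj_pin_steps A A' : pin_steps alg A A' -> steps alg (proj A) (proj A').
Proof.
elim=> [A1 A2 /proj_pin_step // | A1 | A1 A2 A3 _ s12 _ s23].
  exact: rt_refl.
exact: rt_trans s12 s23.
Qed.

(** A rule applicable to the projection would make [V] a countermodel to the entailment between its
    two sides. *)
Lemma proj_saturated A : pin_saturated alg A -> saturated alg (proj A).
Proof.
move=> satA B0 B1 r01 [sB0 nsB1]; apply: (satA _ _ r01) => ent.
by apply: nsB1; rewrite -sat_fm; apply: ent; rewrite sat_fm.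
Qed.

End Projection.

Theorem theorem2 (T X : choiceType) (L : {pred T}) (lab : T -> X)
    (lab_unique : {in L &, injective lab})
    (P : {fset T} -> T -> Prop) (P_c_property : c_property L P)
    (alg : cb_algorithm L) (alg_correct : correct alg P)
    (O : {fset T}) (O_ontology : ontology L O) (O_normal : normal_form alg O)
    (a : T) (a_axiom : a \in L) (Pa : P O a) (a_in_scope : in_scope alg P O a)
    (A : pin_state T X) (f : mform X)
    (A_reached : pin_steps alg (pin_init lab O) A)
    (Af : A.[? a] = Some f)
    (A_saturated : pin_saturated alg A) :
  pinpointing_formula lab P O a f.
Proof.
move=> V _; set OV := restrict lab O V.
have sOV : OV `<=` O by apply/fsubsetP => b; rewrite !inE => /andP[].
have OV_ontology : ontology L OV.
  by move=> b /(fsubsetP sOV); apply: O_ontology.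
(* Normal form is axiomwise, so it passes to [OV]; hence the projected run starts where the
   algorithm does on input [OV]. *)
have OV_normal : normalize alg OV = OV.
  by apply: normalize_id => // b /(fsubsetP sOV); apply: O_normal.
have run : steps alg (normalize alg OV) (proj V A).
  by rewrite OV_normal /OV -(proj_pin_init lab V O); apply: proj_pin_steps.
have [_ correctOV] := alg_correct _ OV_ontology.
have decides := correctOV _ run (proj_saturated A_saturated).
have -> : sat V f = (a \in proj V A) by rewrite in_proj /label Af.
(* Each direction supplies its own ground for [a] being in [delta alg OV]: entailment in the first,
   derivation by the projected run in the second. *)
split=> [POVa | aA].
  by apply/decides => //; apply: a_in_scope sOV _; left.
by apply/decides => //; apply: a_in_scope sOV _; right; exists (proj V A).
Qed.
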